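(* Let $n\in\mathbb{N}$ and let $f\in\mathbb{C}[x_1,\dots,x_n]$ be a quasihomogeneous polynomial with an isolated singularity at $0$ and with reduced weight system $(v_1,\dots,v_n,d)\in\mathbb{N}^{n+1}$ such that $v_i\le \frac{d}{2}$ for all $i$. Let $\mu$ be the Milnor number of $f$ at $0$. (a) Then $$d\le l(n)\cdot \mu .$$ (b) If $v_i<\frac{d}{2}$ for all $i$ and $n\ge 2$, then $$d\le l(n-1)\cdot\mu .$$
   Context: $\mathbb{N}=\{1,2,\dots\}$. A polynomial $f=\sum_\alpha c_\alpha x^\alpha\in\mathbb{C}[x_1,\dots,x_n]$ is quasihomogeneous with weight system $(v_1,\dots,v_n,d)$ if $\sum_{i=1}^n\alpha_i v_i=d$ for every exponent $\alpha$ with $c_\alpha\neq 0$; the $v_i$ are the weights and $d$ is the weighted degree. The weight system $(v_1,\dots,v_n,d)\in\mathbb{N}^{n+1}$ is reduced if $\gcd(v_1,\dots,v_n,d)=1$. A quasihomogeneous polynomial $f$ has an isolated singularity at $0$ if the partial derivatives $\frac{\partial f}{\partial x_i}$, $i=1,\dots,n$, vanish simultaneously precisely at $0\in\mathbb{C}^n$. The Milnor number is $\mu=\dim_{\mathbb{C}}\mathcal{O}_{\mathbb{C}^n,0}/\left(\frac{\partial f}{\partial x_1},\dots,\frac{\partial f}{\partial x_n}\right)$. Let $p_i$ denote the $i$-th prime number ($p_1=2$, $p_2=3$, ...), and for $n\in\mathbb{N}$ define $$l(n):=\prod_{i=1}^n\frac{p_i}{p_i-1}.$$ *)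

(* Defs.v *)
From mathcomp Require Import all_boot all_order all_algebra.
From mathcomp Require Import reals.
From mathcomp Require Import complex mpoly.

Set Implicit Arguments.
Unset Strict Implicit.
Unset Printing Implicit Defensive.

Import Order.TTheory GRing.Theory Num.Theory.
Local Open Scope ring_scope.
Local Open Scope complex_scope.

Lemma exists_prime_above (m : nat) : exists p : nat, (m < p)%N && prime p.
Proof. by have [p m_lt_p p_prime] := prime_above m; exists p; apply/andP. Qed.

Definition next_prime (m : nat) : nat := ex_minn (exists_prime_above m).

(* Indexed from 1: nth_prime 1 = 2, nth_prime 2 = 3; nth_prime 0 = 0 is a
   dummy value. *)
Definition nth_prime (i : nat) : nat := iter i next_prime 0%N.

Definition l (n : nat) : rat :=
  \prod_(1 <= i < n.+1) ((nth_prime i)%:R / ((nth_prime i)%:R - 1)).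

Definition quasihomogeneous (R : realType) (n : nat) (f : {mpoly R[i][n]})
    (v : 'I_n -> nat) (d : nat) : Prop :=
  forall m : 'X_{1..n}, f@_m != 0 -> (\sum_(i < n) m i * v i)%N = d.

Definition reduced (n : nat) (v : 'I_n -> nat) (d : nat) : Prop :=
  gcdn (\big[gcdn/0%N]_(i < n) v i) d = 1%N.

Definition isolated_singularity (R : realType) (n : nat)
    (f : {mpoly R[i][n]}) : Prop :=
  forall x : 'I_n -> R[i],
    (forall i : 'I_n, f^`M(i).@[x] = 0) <-> (forall i : 'I_n, x i = 0).

(* The local ring of germs of holomorphic functions at 0 in C^n is represented
   by the ring of convergent power series in n variables: a formal series is
   its family of coefficients. *)
Definition power_series (R : realType) (n : nat) : Type := 'X_{1..n} -> R[i].

(* Absolute convergence on some closed polydisc of polyradius (r, ..., r). *)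
Definition convergent (R : realType) (n : nat) (a : power_series R n) : Prop :=
  exists2 r : R, 0 < r & exists M : R, forall N : nat,
    \sum_(m : 'X_{1..n < N}) `|a m| * r%:C ^+ mdeg m <= M%:C.

Definition series_mul (R : realType) (n : nat) (a b : power_series R n) :
    power_series R n :=
  fun m => \sum_(k : 'X_{1..n < (mdeg m).+1} | (k <= m)%MM)
             a k * b (m - k)%MM.

Definition series_of_mpoly (R : realType) (n : nat) (p : {mpoly R[i][n]}) :
    power_series R n :=
  fun m => p@_m.

(* The ideal of the local ring generated by the partial derivatives of f. *)
Definition jacobian_ideal (R : realType) (n : nat) (f : {mpoly R[i][n]})
    (h : power_series R n) : Prop :=
  exists2 a : 'I_n -> power_series R n, forall i : 'I_n, convergent (a i) &
    forall m : 'X_{1..n},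
      h m = \sum_(i < n) series_mul (a i) (series_of_mpoly f^`M(i)) m.

Definition lincomb (R : realType) (n k : nat) (c : 'I_k -> R[i])
    (g : 'I_k -> power_series R n) : power_series R n :=
  fun m => \sum_(j < k) c j * g j m.

(* mu is the dimension over C of the local ring modulo the jacobian ideal:
   some mu germs have classes that form a basis of the quotient. *)
Definition is_milnor_number (R : realType) (n : nat) (f : {mpoly R[i][n]})
    (mu : nat) : Prop :=
  exists g : 'I_mu -> power_series R n,
    [/\ forall j : 'I_mu, convergent (g j),
        forall h : power_series R n, convergent h ->
          exists c : 'I_mu -> R[i],
            jacobian_ideal f (fun m => h m - lincomb c g m) &
        forall c : 'I_mu -> R[i],
          jacobian_ideal f (lincomb c g) -> forall j : 'I_mu, c j = 0].

(* Main.v *)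
Require Import Defs.
From mathcomp Require Import all_boot all_order all_algebra.
From mathcomp Require Import reals complex mpoly.
From mathcomp Require Import zify ring lra.

(* Put c(w, N) = #{a in N^n : sum a_i w_i <= N}. If some mu germs g_j span the
   local ring modulo the Jacobian ideal, then expanding repeatedly shows that
   the g_j * prod_i (df/dx_i)^(b_i) span it modulo terms of weight > N, and only
   exponents b with sum b_i (d - v_i) <= N matter; hence
   c(v, N) <= mu * c(d - v, N), and letting N grow, prod (d - v_i)/v_i <= mu.

   Restricting the partial derivatives to the i-th coordinate axis gives a map
   kap on the indices and al_i with al_i v_i + v_(kap i) = d. Since the weight
   system is reduced, d is the common denominator of the v_i/d; these
   denominators are computed along the functional graph of kap, where a vertex
   contributes a factor al_i and a cycle with product A = prod al_i contributes
   A - (-1)^length. Comparing with (d - v_i)/v_i = al_i u_i / u_(kap i), where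
   u_i = 1 - v_i/d, everything except the ends of the graph telescopes: there
   are P and at most n integers x > 1 (one for each leaf and each isolated odd
   cycle) such that d divides P * lcm(x) and P * prod (x - 1) <= mu. Finally
   lcm(x) <= l(#x) * prod (x - 1), the extremal case being that the x are the
   first primes. *)

Set Implicit Arguments.
Unset Strict Implicit.
Unset Printing Implicit Defensive.

Import Order.TTheory GRing.Theory Num.Theory.

(** * Weighted degrees and the number of lattice points in a weighted simplex *)

Definition wt n (w : 'I_n -> nat) (m : 'X_{1..n}) : nat :=
  (\sum_(i < n) m i * w i)%N.

Lemma wtD n (w : 'I_n -> nat) (m1 m2 : 'X_{1..n}) :
  wt w (m1 + m2)%MM = (wt w m1 + wt w m2)%N.
Proof.
by rewrite /wt -big_split; apply: eq_bigr => i _; rewrite mnmDE mulnDl.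
Qed.

Lemma wtU n (w : 'I_n -> nat) (i : 'I_n) : wt w U_(i)%MM = w i.
Proof.
rewrite /wt (bigD1 i) //= mnm1E eqxx mul1n big1 ?addn0 // => j neq_ji.
by rewrite mnm1E eq_sym (negPf neq_ji).
Qed.

Lemma mdeg_le_wt n (w : 'I_n -> nat) (hw : forall i, (0 < w i)%N) m :
  (mdeg m <= wt w m)%N.
Proof. by rewrite mdegE; apply: leq_sum => i _; apply: leq_pmulr. Qed.

Definition wt_le n (w : 'I_n -> nat) (N : nat) : {set 'X_{1..n < N.+1}} :=
  [set m : 'X_{1..n < N.+1} | (wt w m <= N)%N].

(** The exponents of these monomials are the [n]-tuples of sum at most [N], a known binomial
    count. *)
Lemma card_bmultinom n N : #|{: 'X_{1..n < N.+1}}| = 'C(N + n, n).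
Proof.
rewrite addnC -card_partial_ord_partitions.
pose F (m : 'X_{1..n < N.+1}) : n.-tuple 'I_N.+1 :=
  [tuple inord (bmnm m i) | i < n].
have mE (m : 'X_{1..n < N.+1}) i :
    (inord (bmnm m i) : 'I_N.+1) = bmnm m i :> nat.
  rewrite inordK // (leq_ltn_trans _ (bmdeg m)) // mdegE.
  by rewrite (bigD1 i) //= leq_addr.
have injF : injective F.
  move=> m1 m2 /(congr1 (@tnth _ _)) eqF; apply/val_inj/mnmP => i /=.
  by have := congr1 (fun h => val (h i)) eqF; rewrite !tnth_mktuple /= !mE.
rewrite -cardsT -(card_imset _ injF); congr #|pred_of_set _|.
apply/setP => t; rewrite inE; apply/imsetP/idP => [[m _ ->]|ht].
  rewrite big_tuple -ltnS; apply: leq_trans (bmdeg m); rewrite mdegE ltnS.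
  by apply: leq_sum => i _; rewrite tnth_mktuple mE.
have deg_t : mdeg [multinom (tnth t i : nat) | i < n] < N.+1.
  rewrite ltnS mdegE; move: ht; rewrite big_tuple; apply: leq_trans.
  by apply: leq_sum => i _; rewrite mnmE.
exists (BMultinom deg_t) => //; apply: eq_from_tnth => i.
by rewrite tnth_mktuple mnmE inord_val.
Qed.

Section Count.
Variables (n : nat) (w : 'I_n -> nat).
Hypothesis w_gt0 : forall i, 0 < w i.

Let residues := {dffun forall i : 'I_n, 'I_(w i)}.

Lemma card_residues : #|{: residues}| = \prod_i w i.
Proof.
rewrite card_dep_ffun foldrE big_image.
by apply: eq_bigr => i _; rewrite card_ord.
Qed.

(* Both bounds on the number of lattice points come from Euclidean division:
   gamma_i = w_i * beta_i + r_i with r_i < w_i. *)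
Lemma bin_le_card_wt_le N : 'C(N + n, n) <= \prod_i w i * #|wt_le w N|.
Proof.
rewrite -card_bmultinom -card_residues -[#|{: residues}|]cardsT -cardsX.
have wt_div (m : 'X_{1..n < N.+1}) :
    wt w [multinom bmnm m i %/ w i | i < n] < N.+1.
  apply: leq_ltn_trans (bmdeg m); rewrite mdegE.
  by apply: leq_sum => i _; rewrite mnmE leq_trunc_div.
pose quo m := BMultinom (leq_ltn_trans (mdeg_le_wt w_gt0 _) (wt_div m)).
pose rest (m : 'X_{1..n < N.+1}) : residues :=
  [ffun i => Ordinal (ltn_pmod (bmnm m i) (w_gt0 i))].
have injF : injective (fun m => (rest m, quo m)).
  move=> m1 m2 eq12; apply/val_inj/mnmP => i /=.
  have /(congr1 val) /= := congr1 (fun y => (fst y : residues) i) eq12.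
  have /= := congr1 (fun y => bmnm y.2 i) eq12.
  rewrite !ffunE !mnmE /= => div12 mod12.
  rewrite (divn_eq (bmnm m1 i) (w i)) (divn_eq (bmnm m2 i) (w i)).
  by rewrite div12 mod12.
rewrite -[X in X <= _]cardsT -(card_imset _ injF).
apply/subset_leq_card/subsetP => _ /imsetP[m _ ->].
by rewrite in_setX !inE /= -ltnS wt_div.
Qed.

Lemma card_wt_le_bin N :
  \prod_i w i * #|wt_le w N| <= 'C(N + \sum_i w i + n, n).
Proof.
rewrite -card_bmultinom -card_residues -[#|{: residues}|]cardsT -cardsX.
pose comb (y : residues * 'X_{1..n < N.+1}) :=
  [multinom bmnm y.2 i * w i + y.1 i | i < n].
have comb_deg y : y \in setX setT (wt_le w N) ->
    mdeg (comb y) < (N + \sum_i w i).+1.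
  case: y => r m; rewrite in_setX !inE /= => hy; rewrite ltnS mdegE.
  under eq_bigr do rewrite mnmE.
  rewrite big_split leq_add //.
  by apply: leq_sum => i _; apply: ltnW (ltn_ord _).
have comb_inj : injective comb.
  move=> [r1 m1] [r2 m2] /(congr1 (fun h : 'X_{1..n} => h : _ -> nat)) eq12.
  have eqi i : m1 i * w i + r1 i = m2 i * w i + r2 i.
    by have := congr1 (@^~ i) eq12; rewrite /= !mnmE.
  have r12 : r1 = r2.
    apply/ffunP => i; apply: val_inj => /=.
    by have := congr1 (modn^~ (w i)) (eqi i); rewrite /= !modnMDl !modn_small.
  congr pair => //; apply/val_inj/mnmP => i /=.
  have /eqP := eqi i; rewrite r12 eqn_add2r eqn_pmul2r //.
  by move/eqP.
(* By [comb_deg] the default [bm0] is never taken on the set where [F] is used. *)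
pose F y : 'X_{1..n < (N + \sum_i w i).+1} := insubd bm0 (comb y).
have injF : {in setX setT (wt_le w N) &, injective F}.
  move=> y1 y2 /comb_deg h1 /comb_deg h2 /(congr1 val).
  by rewrite !val_insubd h1 h2; apply: comb_inj.
by rewrite -(card_in_imset injF) max_card.
Qed.

End Count.

(** * Comparing the growth of shifted binomial coefficients *)

Lemma ffact_ratio N E n :
  (N + E + n) ^_ n * N.+1 ^ n <= (N + n) ^_ n * (N.+1 + E) ^ n.
Proof.
elim: n => [|n IH]; first by rewrite !ffactn0.
rewrite !addnS !ffactSS !expnS.
(* Adding [n] to both terms of (N + 1 + E) / (N + 1), a ratio at least 1, can only lower it. *)
have step : (N + E + n).+1 * N.+1 <= (N + n).+1 * (N.+1 + E).
  by rewrite !(mulSn, mulnS, mulnDl, mulnDr); lia.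
have := leq_mul step IH; congr (_ <= _); ring.
Qed.

Lemma leq_expn2r k1 k2 n : k1 <= k2 -> k1 ^ n <= k2 ^ n.
Proof. by case: n => // n le12; rewrite leq_exp2r. Qed.

(** Bernoulli's inequality for (1 - 1/(K+1))^n, with denominators cleared. *)
Lemma bernoulli_nat K n :
  K.+1 ^ n * K.+1 <= K ^ n * K.+1 + n * K.+1 ^ n.
Proof.
elim: n => [|n IH]; first by rewrite addn0.
have le_pow : K ^ n <= K.+1 ^ n by apply: leq_expn2r.
rewrite !expnS; nia.
Qed.

(* Only the leading coefficient in N matters: the ratio of the two binomials is
   at most (1 + E/(N+1))^n, and N is taken so large that Bernoulli's inequality
   makes this smaller than 1 + 1/Y. *)
Lemma binomial_growth X Y E n :
  (forall N, X * 'C(N + n, n) <= Y * 'C(N + E + n, n)) -> X <= Y.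
Proof.
move=> hXY; rewrite leqNgt; apply/negP => ltYX.
(* This [K] makes the Bernoulli loss n/(K+2) smaller than 1/(Y+1), and this [N] gives 1 + E/(N+1) <=
   (K+2)/(K+1). *)
pose K := n * Y.+1; pose N := (K.+1 * E.+1).-1.
have N1 : N.+1 = K.+1 * E.+1 by rewrite prednK.
have bin_gt : 0 < (N + n) ^_ n by rewrite ffact_gt0 leq_addl.
have h1 : Y.+1 * (N + n) ^_ n <= Y * (N + E + n) ^_ n.
  rewrite -!bin_ffact !mulnA leq_mul //.
  by apply: leq_trans (hXY N); rewrite leq_mul.
have h2 : Y.+1 * N.+1 ^ n <= Y * (N.+1 + E) ^ n.
  rewrite -(leq_pmul2l bin_gt).
  have := leq_mul h1 (leqnn (N.+1 ^ n)).
  have := leq_mul (leqnn Y) (ffact_ratio N E n).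
  rewrite -[_ * _ * N.+1 ^ n]mulnA [X in _ -> X <= _ -> _]mulnA.
  nia.
have h3 : Y.+1 * K.+1 ^ n <= Y * K.+2 ^ n.
  have E_gt0 : 0 < E.+1 ^ n by rewrite expn_gt0.
  rewrite -(leq_pmul2r E_gt0) -!mulnA -!expnMn -N1.
  apply: leq_trans h2 _; rewrite leq_mul2l; apply/orP; right.
  by apply: leq_expn2r; rewrite N1; lia.
have := bernoulli_nat K.+1 n; have : 0 < K.+2 ^ n by rewrite expn_gt0.
rewrite {1}/K; nia.
Qed.

(** * The enumeration of the primes *)

Lemma next_primeP m : (m < next_prime m) && prime (next_prime m).
Proof. by rewrite /next_prime; case: ex_minnP. Qed.

Lemma next_prime_min m p : m < p -> prime p -> next_prime m <= p.
Proof.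
move=> ltmp pr_p; rewrite /next_prime; case: ex_minnP => q _.
by apply; rewrite ltmp.
Qed.

Lemma nth_prime_ge2 i : 1 < nth_prime i.+1.
Proof. by apply: prime_gt1; have /andP[] := next_primeP (nth_prime i). Qed.

Lemma nth_prime_ge3 i : 2 < nth_prime i.+2.
Proof.
by apply: leq_ltn_trans (nth_prime_ge2 i) (proj1 (andP (next_primeP _))).
Qed.

Lemma nth_prime1 : nth_prime 1 = 2.
Proof.
by apply/eqP; rewrite eqn_leq nth_prime_ge2 andbT next_prime_min.
Qed.

Local Open Scope ring_scope.
Local Open Scope complex_scope.

(** * Spanning polynomials modulo high weight *)

Lemma mcoeffM_lt_eq0 n (K : fieldType) (w : 'I_n -> nat) (e1 e2 : nat)
    (p1 p2 : {mpoly K[n]}) :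
  (forall m, (wt w m < e1)%N -> p1@_m = 0) ->
  (forall m, (wt w m < e2)%N -> p2@_m = 0) ->
  forall m, (wt w m < e1 + e2)%N -> (p1 * p2)@_m = 0.
Proof.
move=> h1 h2 m hm; rewrite mcoeffM big1 // => k /eqP def_m.
have [lt1|ge1] := ltnP (wt w k.1) e1; first by rewrite h1 // mul0r.
rewrite h2 ?mulr0 // ltnNge; apply/negP => ge2.
by move: hm; rewrite def_m wtD ltnNge leq_add.
Qed.

(** The rows [F y] restricted to [A] span every unit vector, so their matrix has rank [#|A|], at
    most its number of rows. *)
Lemma card_le_of_span (K : fieldType) (X Y : finType) (A : {set X})
    (B : {set Y}) (F : Y -> X -> K) :
  (forall x0, x0 \in A -> exists c : Y -> K,
     forall x, x \in A -> (x0 == x)%:R = \sum_(y in B) c y * F y x) ->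
  (#|A| <= #|B|)%N.
Proof.
move=> spanF.
pose M : 'M[K]_(#|B|, #|A|) := \matrix_(r, s) F (enum_val r) (enum_val s).
have fullM : row_full M.
  rewrite -sub1mx; apply/row_subP => r.
  have [c hc] := spanF _ (enum_valP r).
  apply/submxP; exists (\row_s c (enum_val s)).
  apply/rowP => s; rewrite !mxE.
  under eq_bigr do rewrite !mxE.
  rewrite -(inj_eq enum_val_inj) hc ?enum_valP //.
  by rewrite big_enum_val.
by rewrite -(eqP fullM) rank_leq_row.
Qed.

Section Span.
Variables (K : fieldType) (n N mu : nat) (v e : 'I_n -> nat).
Hypotheses (v_gt0 : forall i, (0 < v i)%N) (e_gt0 : forall i, (0 < e i)%N).
Variable q : 'I_n -> {mpoly K[n]}.
Hypothesis q_homog : forall i m, (q i)@_m != 0 -> wt v m = e i.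
Variable g : 'I_mu -> {mpoly K[n]}.
Hypothesis g_span : forall p : {mpoly K[n]},
  exists c : 'I_mu -> K, exists a : 'I_n -> {mpoly K[n]},
  forall m, (mdeg m <= N)%N ->
    p@_m = (\sum_j c j *: g j + \sum_i a i * q i)@_m.

Let qpow (b : 'X_{1..n}) : {mpoly K[n]} := \prod_i q i ^+ b i.

Let spanned (p : {mpoly K[n]}) : Prop :=
  exists c : 'I_mu * 'X_{1..n < N.+1} -> K, forall m, (wt v m <= N)%N ->
    p@_m = \sum_(y in setX setT (wt_le e N)) c y * (g y.1 * qpow y.2)@_m.

Lemma spanned_congr p1 p2 :
  (forall m, (wt v m <= N)%N -> p1@_m = p2@_m) -> spanned p2 -> spanned p1.
Proof. by move=> eq12 [c hc]; exists c => m hm; rewrite eq12 ?hc. Qed.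

Lemma spanned0 : spanned 0.
Proof.
by exists (fun=> 0) => m _; rewrite mcoeff0 big1 // => y _; rewrite mul0r.
Qed.

Lemma spannedD p1 p2 : spanned p1 -> spanned p2 -> spanned (p1 + p2).
Proof.
move=> [c1 h1] [c2 h2]; exists (fun y => c1 y + c2 y) => m hm.
rewrite mcoeffD h1 // h2 // -big_split.
by apply: eq_bigr => y _; rewrite mulrDl.
Qed.

Lemma spanned_sum (I : finType) (F : I -> {mpoly K[n]}) :
  (forall i, spanned (F i)) -> spanned (\sum_i F i).
Proof.
move=> hF; apply: (big_ind spanned) => //; [exact: spanned0|exact: spannedD].
Qed.

Lemma spannedZ a j (b : 'X_{1..n < N.+1}) :
  b \in wt_le e N -> spanned (a *: (g j * qpow b)).
Proof.
move=> hb; exists (fun y => if y == (j, b) then a else 0) => m _.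
rewrite (bigD1 (j, b)) /=; last by rewrite in_setX inE.
rewrite eqxx mcoeffZ big1 ?addr0 // => y /andP[_ /negPf ->].
by rewrite mul0r.
Qed.

Lemma qpow_order b m : (wt v m < wt e b)%N -> (qpow b)@_m = 0.
Proof.
rewrite /qpow /wt; move: m.
apply: (big_ind2 (fun (p : {mpoly K[n]}) k =>
  forall m, (wt v m < k)%N -> p@_m = 0)) => //.
  by move=> p1 k1 p2 k2; apply: mcoeffM_lt_eq0.
move=> i _; elim: (b i) => [|k IH] //.
rewrite exprS mulSn; apply: mcoeffM_lt_eq0 => // m.
by apply: contraTeq => /q_homog ->; rewrite ltnn.
Qed.

Lemma qpowU i b : q i * qpow b = qpow (b + U_(i))%MM.
Proof.
rewrite /qpow [RHS](bigD1 i) // [X in _ * X](bigD1 i) //= mulrA.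
rewrite mnmDE mnm1E eqxx addn1 exprS; congr (_ * _).
apply: eq_bigr => j neq_ji.
by rewrite mnmDE mnm1E eq_sym (negPf neq_ji) addn0.
Qed.

(* Descending induction on the weight of the multiplier [qpow b]: once it is over
   N, the product vanishes in the weights that matter. *)
Lemma spanned_qpow k : forall b p, (N < wt e b + k)%N -> spanned (p * qpow b).
Proof.
elim: k => [|k IH] b p hk.
  apply: spanned_congr spanned0 => m hm; rewrite mcoeff0.
  apply: (@mcoeffM_lt_eq0 _ _ v 0 (wt e b)) => // [m'|].
    exact: qpow_order.
  by rewrite addn0 in hk; apply: leq_ltn_trans hk.
have [hb|hb] := ltnP N (wt e b); first by apply: (IH b p); apply: ltn_addr.
have [c [a hca]] := g_span p.
pose r := \sum_j c j *: g j + \sum_i a i * q i.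
have deg_b : (mdeg b < N.+1)%N by rewrite ltnS (leq_trans _ hb) ?mdeg_le_wt.
(* [p] and [r] agree in degrees up to [N]; as degree is at most weight and all weights are positive,
   their difference only affects weights above [N]. *)
apply: (@spanned_congr _ (r * qpow b)).
  move=> m hm; apply/eqP; rewrite -subr_eq0 -mcoeffB -mulrBl; apply/eqP.
  apply: (@mcoeffM_lt_eq0 _ _ (fun=> 1%N) N.+1 0) => // [m' hm'|].
    rewrite mcoeffB hca ?subrr //; rewrite -ltnS (leq_trans _ hm') //.
    by rewrite ltnS mdeg_le_wt.
  rewrite addn0 ltnS (leq_trans _ hm) //.
  by apply: leq_sum => i _; rewrite muln1 leq_pmulr.
rewrite /r mulrDl !mulr_suml; apply: spannedD; apply: spanned_sum => i.
  rewrite -scalerAl.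
  by apply: (@spannedZ (c i) i (BMultinom deg_b)); rewrite inE.
rewrite -mulrA qpowU; apply: IH; rewrite wtD wtU -addnA.
by rewrite (leq_trans hk) // leq_add2l -addn1 addnC leq_add2r e_gt0.
Qed.

Lemma card_wt_le : (#|wt_le v N| <= mu * #|wt_le e N|)%N.
Proof.
rewrite -[mu in leqRHS]card_ord -cardsT -cardsX.
pose F (y : 'I_mu * 'X_{1..n < N.+1}) (m : 'X_{1..n < N.+1}) :=
  (g y.1 * qpow y.2)@_m.
apply: (@card_le_of_span K _ _ _ _ F) => m0 _.
(* The multiplier with exponent 0 is 1, so each monomial is itself spanned. *)
have [|c hc] := @spanned_qpow N.+1 0%MM 'X_[m0]; first exact: leq_addl.
exists c => m; rewrite inE => /hc <-.
have -> : qpow 0%MM = 1 by rewrite /qpow big1 // => i _; rewrite mnm0E.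
by rewrite mulr1 mcoeffX.
Qed.

End Span.

(** * From the Milnor number to a bound on the product of (d - v_i)/v_i *)

Section MilnorBound.
Variables (R : realType) (n : nat).

Lemma convergent_mpoly (p : {mpoly R[i][n]}) :
  convergent (series_of_mpoly p).
Proof.
exists 1; first exact: ltr01.
(* Norms in [R[i]] are complex-valued; the sum of all moduli is real, and its real part serves as
   the bound. *)
exists (complex.Re (\sum_(m <- msupp p) `|p@_m|)) => N.
rewrite RRe_real; last first.
  by rewrite ger0_real // sumr_ge0.
under eq_bigr do rewrite expr1n mulr1.
rewrite -(big_map (@bmnm n N) xpredT (fun m => `|p@_m|)).
rewrite (bigID (mem (msupp p))) /= [X in _ + X]big1 ?addr0; last first.
  by move=> m; rewrite -mcoeff_eq0 => /eqP ->; rewrite normr0.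
rewrite -big_filter.
rewrite [leRHS](bigID (mem [seq bmnm m | m <- index_enum 'X_{1..n < N}])) /=.
rewrite -[X in _ <= X + _]big_filter.
set s1 := filter _ _; set s2 := filter _ _.
have perm12 : perm_eq s1 s2.
  apply: uniq_perm.
  - by rewrite filter_uniq // map_inj_uniq ?index_enum_uniq //; apply: val_inj.
  - by rewrite filter_uniq // msupp_uniq.
  - by move=> m; rewrite !mem_filter andbC.
by rewrite (perm_big _ perm12) lerDl sumr_ge0.
Qed.

Definition trunc (N : nat) (a : power_series R n) : {mpoly R[i][n]} :=
  \sum_(m : 'X_{1..n < N.+1}) a m *: 'X_[m].

Lemma mcoeff_trunc N a m : (mdeg m <= N)%N -> (trunc N a)@_m = a m.
Proof. by move=> hm; rewrite mcoeff_mpoly. Qed.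

(** A coefficient of a product only involves coefficients of no larger degree, so truncation above
    [N] is invisible. *)
Lemma mcoeff_truncM N a (p : {mpoly R[i][n]}) m : (mdeg m <= N)%N ->
  (trunc N a * p)@_m = series_mul a (series_of_mpoly p) m.
Proof.
move=> hm; rewrite (@mcoeff_poly_mul_lin _ _ _ _ _ (mdeg m).+1) //.
apply: eq_bigr => k _; rewrite mcoeff_trunc // -ltnS.
by apply: leq_trans (bmdeg k) _; rewrite ltnS.
Qed.

Lemma mcoeff_mderiv_wt (f : {mpoly R[i][n]}) v d i m :
  quasihomogeneous f v d -> (f^`M(i))@_m != 0 -> (wt v m + v i)%N = d.
Proof.
move=> hf; rewrite mcoeff_mderiv => hm.
have /hf <- : f@_(m + U_(i)) != 0.
  by apply: contraNneq hm => ->; rewrite mul0rn.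
by rewrite -[LHS]/(_ + _)%N -wtU -wtD.
Qed.

(** After truncation the basis germs are polynomials, and the i-th partial derivative is homogeneous
    of weight [d - v i]; these are the data of [card_wt_le]. *)
Lemma card_wt_le_milnor (f : {mpoly R[i][n]}) v d mu N :
  (forall i, 0 < v i)%N -> (forall i, v i < d)%N ->
  quasihomogeneous f v d -> is_milnor_number f mu ->
  (#|wt_le v N| <= mu * #|wt_le (fun i => (d - v i)%N) N|)%N.
Proof.
move=> v_gt0 v_lt hf [g [g_conv g_span _]].
apply: (@card_wt_le _ n N mu v _ v_gt0 _ (fun i => f^`M(i)) _
  (fun j => trunc N (g j))) => [i|i m /(mcoeff_mderiv_wt hf) <-|p].
- by rewrite subn_gt0.
- by rewrite addnK.
have [c [a _ hca]] := g_span _ (convergent_mpoly p).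
exists c, (fun i => trunc N (a i)) => m hm.
rewrite mcoeffD !raddf_sum /=.
have /eqP := hca m; rewrite subr_eq addrC -[series_of_mpoly p m]/(p@_m).
move=> /eqP ->; congr (_ + _); apply: eq_bigr => i _.
  by rewrite mcoeffZ mcoeff_trunc.
by rewrite mcoeff_truncM.
Qed.

End MilnorBound.

(** Both lattice point counts are replaced by binomials, whose leading terms in [N] are then
    compared by [binomial_growth]. *)
Lemma prod_degree_le_milnor (R : realType) n (f : {mpoly R[i][n]}) v d mu :
  (forall i, 0 < v i)%N -> (forall i, v i < d)%N ->
  quasihomogeneous f v d -> is_milnor_number f mu ->
  (\prod_i (d - v i) <= mu * \prod_i v i)%N.
Proof.
move=> v_gt0 v_lt hf hmu.
have dv_gt0 i : (0 < d - v i)%N by rewrite subn_gt0.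
apply: (@binomial_growth _ _ (\sum_i (d - v i))%N n) => N.
apply: leq_trans (leq_mul (leqnn _) (bin_le_card_wt_le v_gt0 N)) _.
apply: leq_trans (leq_mul (leqnn _) (card_wt_le_bin dv_gt0 N)).
have := card_wt_le_milnor N v_gt0 v_lt hf hmu.
move/(leq_mul (leqnn (\prod_i (d - v i) * \prod_i v i)%N)).
by congr (_ <= _)%N; ring.
Qed.

(** * Products of x/(x - 1) over coprime integers, compared with [l] *)

(* The factors of [l]; the value at 1 is the junk value 0. *)
Definition pred_ratio (x : nat) : rat := x%:R / (x%:R - 1).

Lemma pred_ratio_gt0 x : (1 < x)%N -> 0 < pred_ratio x.
Proof.
move=> x_gt1; rewrite divr_gt0 ?ltr0n ?subr_gt0 ?ltr1n //.
exact: ltn_trans x_gt1.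
Qed.

Lemma pred_ratio_ge1 x : (1 < x)%N -> 1 <= pred_ratio x.
Proof.
move=> x_gt1; rewrite ler_pdivlMr ?subr_gt0 ?ltr1n // mul1r.
by rewrite lerBlDr lerDl.
Qed.

Lemma pred_ratioM x : (1 < x)%N -> pred_ratio x * (x%:R - 1) = x%:R.
Proof. by move=> x_gt1; rewrite divfK // subr_eq0 pnatr_eq1 gtn_eqF. Qed.

Lemma pred_ratio_le x y :
  (1 < x)%N -> (x <= y)%N -> pred_ratio y <= pred_ratio x.
Proof.
move=> x_gt1 le_xy; have y_gt1 := leq_trans x_gt1 le_xy.
rewrite ler_pdivrMr ?subr_gt0 ?ltr1n // mulrAC.
rewrite ler_pdivlMr ?subr_gt0 ?ltr1n //.
have : x%:R <= y%:R :> rat by rewrite ler_nat.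
lra.
Qed.

Lemma lS n : l n.+1 = l n * pred_ratio (nth_prime n.+1).
Proof. by rewrite /l big_nat_recr. Qed.

Lemma l_gt0 n : 0 < l n.
Proof.
elim: n => [|n IH]; first by rewrite /l big_geq.
by rewrite lS mulr_gt0 // pred_ratio_gt0 // nth_prime_ge2.
Qed.

Lemma l_le m n : (m <= n)%N -> l m <= l n.
Proof.
move/subnK <-; elim: (n - m)%N => // k IH; apply: le_trans IH _.
by rewrite addSn lS ler_peMr ?pred_ratio_ge1 ?nth_prime_ge2 // ltW // l_gt0.
Qed.

(** The first entry is at least the prime following [nth_prime k], and [pred_ratio] is decreasing;
    then [k] moves up by one. *)
Lemma prod_pred_ratio_sorted_primes k s : sorted ltn s -> all prime s ->
  all (ltn (nth_prime k)) s ->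
  \prod_(x <- s) pred_ratio x <=
  \prod_(k.+1 <= i < k.+1 + size s) pred_ratio (nth_prime i).
Proof.
elim: s k => [|x s IH] k /=; first by rewrite big_nil big_geq ?addn0.
rewrite path_sortedE; last exact: ltn_trans.
move=> /andP[lt_x_s srt] /andP[pr_x pr_s] /andP[lt_kx _].
have le_x : (nth_prime k.+1 <= x)%N by apply: next_prime_min.
rewrite big_cons big_ltn ?addnS ?ltnS ?leq_addr //.
rewrite ler_pM //.
- by rewrite ltW // pred_ratio_gt0 // prime_gt1.
- rewrite big_seq prodr_ge0 // => y /(allP pr_s) /prime_gt1 y_gt1.
  by rewrite ltW // pred_ratio_gt0.
- by apply: pred_ratio_le; rewrite ?nth_prime_ge2.
rewrite -addSn IH //; apply: sub_all lt_x_s => y; exact: leq_ltn_trans.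
Qed.

(** Passing to least prime factors does not lower [pred_ratio], and coprimality keeps these primes
    distinct. *)
Lemma prod_pred_ratio_coprime_pdiv k ys :
  all (ltn 1%N) ys -> pairwise coprime ys ->
  all (ltn (nth_prime k)) (map pdiv ys) ->
  \prod_(y <- ys) pred_ratio y <=
  \prod_(k.+1 <= i < k.+1 + size ys) pred_ratio (nth_prime i).
Proof.
move=> ys_gt1 cop_ys lt_k.
have pr_ys : all prime (map pdiv ys).
  by rewrite all_map; apply: sub_all ys_gt1 => y; apply: pdiv_prime.
have uniq_p : uniq (map pdiv ys).
  rewrite uniq_pairwise pairwise_map; apply: sub_in_pairwise ys_gt1 cop_ys.
  move=> x y x_gt1 y_gt1 cop_xy /=; apply/eqP => eq_p.
  have : (pdiv x %| gcdn x y)%N by rewrite dvdn_gcd pdiv_dvd eq_p pdiv_dvd.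
  rewrite (eqP cop_xy) dvdn1 => /eqP p1.
  by have := pdiv_prime x_gt1; rewrite p1.
apply: (@le_trans _ _ (\prod_(x <- sort leq (map pdiv ys)) pred_ratio x)).
  rewrite (perm_big _ (permEl (perm_sort _ _))) /=.
  rewrite big_map big_seq [leRHS]big_seq; apply: ler_prod => y /(allP ys_gt1).
  move=> y_gt1; rewrite ltW ?pred_ratio_gt0 //= pred_ratio_le //.
    by rewrite prime_gt1 // pdiv_prime.
  by rewrite dvdn_leq ?pdiv_dvd // ltnW.
have := @prod_pred_ratio_sorted_primes k (sort leq (map pdiv ys)).
rewrite size_sort size_map; apply.
- by rewrite ltn_sorted_uniq_leq sort_uniq uniq_p sort_sorted.
- by rewrite all_sort.
- by rewrite all_sort.
Qed.

(** * Bounding a least common multiple by the product of the x - 1 *)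

Definition lcms (xs : seq nat) : nat := \big[lcmn/1%N]_(x <- xs) x.

Lemma lcms_cons x xs : lcms (x :: xs) = lcmn x (lcms xs).
Proof. by rewrite /lcms big_cons. Qed.

Lemma dvdn_lcms xs x : x \in xs -> (x %| lcms xs)%N.
Proof.
rewrite /lcms; elim: xs => // y xs IH; rewrite inE big_cons => /predU1P[->|/IH].
  exact: dvdn_lcml.
by move=> /dvdn_trans; apply; apply: dvdn_lcmr.
Qed.

Lemma lcms_gt0 xs : all (ltn 1%N) xs -> (0 < lcms xs)%N.
Proof.
rewrite /lcms; elim: xs => [|x xs IH] /=; first by rewrite big_nil.
by move=> /andP[x_gt1 /IH xs_gt0]; rewrite big_cons lcmn_gt0 xs_gt0 ltnW.
Qed.

Lemma prod_subr1_ge0 xs :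
  all (ltn 1%N) xs -> 0 <= \prod_(x <- xs) (x%:R - 1) :> rat.
Proof.
move=> /allP xs_gt1; rewrite big_seq prodr_ge0 // => x /xs_gt1 x_gt1.
by rewrite subr_ge0 ler1n ltnW.
Qed.

(** [ys] keeps an entry exactly when it is coprime to the lcm of all later entries. *)
Lemma lcms_le_coprime xs : all (ltn 1%N) xs -> exists ys,
  [/\ subseq ys xs, pairwise coprime ys &
      (lcms xs)%:R <=
        \prod_(y <- ys) pred_ratio y * \prod_(x <- xs) (x%:R - 1)].
Proof.
elim: xs => [|x xs IH] /=.
  by exists [::]; split=> //; rewrite /lcms !big_nil.
move=> /andP[x_gt1 xs_gt1]; have [ys [sub_ys cop_ys le_ys]] := IH xs_gt1.
have xs_ge0 := prod_subr1_ge0 xs_gt1.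
(* An x sharing a factor with the others at most halves its contribution to the
   lcm, so it contributes at most x - 1 and needs no correcting factor. *)
have [cop_x|ncop_x] := boolP (coprime x (lcms xs)).
  exists (x :: ys); split => //=.
  - by rewrite eqxx.
  - rewrite cop_ys andbT; apply/allP => y /(mem_subseq sub_ys) y_xs.
    by apply: coprime_dvdr cop_x; apply: dvdn_lcms.
  rewrite !big_cons mulrACA pred_ratioM // lcms_cons.
  have <- : (x * lcms xs = lcmn x (lcms xs))%N.
    by rewrite -muln_lcm_gcd (eqP cop_x) muln1.
  by rewrite natrM ler_wpM2l.
exists ys; split=> //.
  exact: subseq_trans sub_ys (subseq_cons _ _).
rewrite big_cons mulrCA lcms_cons.
have gcd_ge2 : (1 < gcdn x (lcms xs))%N.
  rewrite ltn_neqAle eq_sym -/(coprime _ _) ncop_x gcdn_gt0.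
  by rewrite ltnW.
have lcm_le : (lcmn x (lcms xs) <= x.-1 * lcms xs)%N.
  rewrite -(@leq_pmul2r 2) // (leq_trans (leq_mul (leqnn _) gcd_ge2)) //.
  by rewrite muln_lcm_gcd mulnAC leq_mul //; lia.
apply: (@le_trans _ _ ((x%:R - 1) * (lcms xs)%:R)).
  have -> : x%:R - 1 = x.-1%:R :> rat by rewrite -subn1 natrB // ltnW.
  by rewrite -natrM ler_nat.
by rewrite ler_wpM2l // subr_ge0 ler1n ltnW.
Qed.

Lemma prod_pred_ratio_coprime ys : all (ltn 1%N) ys -> pairwise coprime ys ->
  \prod_(y <- ys) pred_ratio y <= l (size ys).
Proof.
move=> ys_gt1 cop_ys; apply: (@prod_pred_ratio_coprime_pdiv 0) => //.
by apply/allP => _ /mapP[y _ ->]; apply: pdiv_gt0.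
Qed.

Lemma lcms_le xs : all (ltn 1%N) xs ->
  (lcms xs)%:R <= l (size xs) * \prod_(x <- xs) (x%:R - 1).
Proof.
move=> xs_gt1; have [ys [sub_ys cop_ys /le_trans]] := lcms_le_coprime xs_gt1.
apply; rewrite ler_wpM2r ?prod_subr1_ge0 //.
have ys_gt1 : all (ltn 1%N) ys.
  by apply/allP => y /(mem_subseq sub_ys) /(allP xs_gt1).
apply: le_trans (prod_pred_ratio_coprime ys_gt1 cop_ys) _.
by rewrite l_le ?size_subseq.
Qed.

(** At most one entry is even, and being above 2 it can be taken as [y]; if all are odd, one of the
    first two differs from 3. The prime factors of the rest start at 3. *)
Lemma coprime_isolate_even ys : all (ltn 2%N) ys -> pairwise coprime ys ->
  (1 < size ys)%N -> exists y zs,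
  [/\ perm_eq ys (y :: zs), (3 < y)%N, all odd zs & pairwise coprime zs].
Proof.
move=> ys_gt2 cop_ys size_ys.
have [odd_ys|] := boolP (all odd ys).
  case: ys ys_gt2 cop_ys size_ys odd_ys => [|x [|y t]] //.
  move=> /and3P[x_gt2 y_gt2 _].
  move=> /andP[/andP[cop_xy cop_xt] /andP[cop_yt cop_t]] _.
  move=> /and3P[odd_x odd_y odd_t].
  have [x_gt3|] := ltnP 3 x.
    exists x, (y :: t); split=> //; first by rewrite /= odd_y.
    exact/andP.
  move=> x_le3; have x3 : x = 3%N by apply/eqP; rewrite eqn_leq x_le3.
  exists y, (x :: t); split=> //.
  - by apply/permPl; apply: (perm_catCA [:: x] [:: y] t).
  - rewrite /= in y_gt2; rewrite ltn_neqAle y_gt2 andbT; apply/eqP => y3.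
    by move: cop_xy; rewrite x3 -y3.
  - by rewrite /= odd_x.
  - exact/andP.
rewrite -has_predC => /hasP[y y_ys /= even_y].
have coprime_odd z : coprime y z -> odd z.
  by apply: contraTT => even_z; rewrite -[z]odd_double_half
    -[y]odd_double_half (negPf even_z) (negPf even_y) -!muln2 !add0n /coprime
    -muln_gcdl muln_eq1 andbF.
have y_gt3 : (3 < y)%N.
  have /= := allP ys_gt2 _ y_ys; rewrite leq_eqVlt => /orP[/eqP y3|//].
  by rewrite -y3 in even_y.
case/splitPr: y_ys cop_ys => p1 p2.
rewrite pairwise_cat allrel_consr /= => /and3P[/andP[cop1 cop12]].
move=> cop_p1 /andP[cop2 cop_p2].
exists y, (p1 ++ p2); split=> //.
- by apply/permPl; apply: (perm_catCA p1 [:: y] p2).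
- rewrite all_cat; apply/andP; split; apply/allP => z hz; apply: coprime_odd.
    by rewrite coprime_sym (allP cop1).
  exact: (allP cop2).
by rewrite pairwise_cat cop12 cop_p1.
Qed.

(** With k = [size zs], the isolated entry gives at most 4/3 and the odd ones at most l(k+1)/2 <=
    l(k) * (3/2)/2; the constants multiply to 1. *)
Lemma prod_pred_ratio_coprime_gt2 ys :
  all (ltn 2%N) ys -> pairwise coprime ys ->
  (1 < size ys)%N -> \prod_(y <- ys) pred_ratio y <= l (size ys).-1.
Proof.
move=> ys_gt2 cop_ys size_ys.
have [y [zs [perm_y y_gt3 odd_zs cop_zs]]] :=
  coprime_isolate_even ys_gt2 cop_ys size_ys.
rewrite (perm_big _ perm_y) big_cons /=.
have size_eq : size ys = (size zs).+1 by rewrite (perm_size perm_y).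
have zs_gt2 : all (ltn 2%N) zs.
  by move: ys_gt2; rewrite (perm_all _ perm_y) /= => /andP[].
have le_y : pred_ratio y <= 4 / 3 by apply: (pred_ratio_le _ y_gt3).
have le_zs : \prod_(z <- zs) pred_ratio z <= l (size zs).+1 / 2.
  have -> : l (size zs).+1 / 2 =
      \prod_(2 <= i < 2 + size zs) pred_ratio (nth_prime i).
    rewrite /l big_ltn // nth_prime1 /pred_ratio add2n (_ : 2 / (2 - 1) = 2) //.
    by rewrite mulrAC divff // mul1r.
  apply: (@prod_pred_ratio_coprime_pdiv 1) => //.
    by apply: sub_all zs_gt2 => z; apply: ltnW.
  rewrite all_map nth_prime1; apply/allP => z hz /=.
  have z_gt2 := allP zs_gt2 _ hz.
  have pr_z : prime (pdiv z) by rewrite pdiv_prime // ltnW.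
  rewrite ltn_neqAle prime_gt1 // andbT; apply/eqP => p2.
  have : (2 %| z)%N by rewrite p2 pdiv_dvd.
  by rewrite dvdn2 (allP odd_zs).
have zs_ge0 : 0 <= \prod_(z <- zs) pred_ratio z.
  rewrite big_seq prodr_ge0 // => z /(allP zs_gt2) z_gt2.
  by rewrite ltW // pred_ratio_gt0 // ltnW.
rewrite size_eq /=; move: le_zs; rewrite lS.
have p_le : pred_ratio (nth_prime (size zs).+1) <= 3 / 2.
  have : (0 < size zs)%N by rewrite -ltnS -size_eq.
  case: (size zs) => // k _.
  by apply: (pred_ratio_le (x := 3)); rewrite ?nth_prime_ge3.
have y_ge0 : 0 < pred_ratio y by apply: pred_ratio_gt0; lia.
have := l_gt0 (size zs).
set L := l _; set P := \prod_(z <- _) _; set e := pred_ratio (nth_prime _).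
move=> L_gt0 le_zs.
have h1 : P <= L * (3 / 2) / 2.
  apply: le_trans le_zs _.
  by rewrite ler_wpM2r // ler_wpM2l // ltW.
apply: le_trans (ler_pM (ltW y_ge0) zs_ge0 le_y h1) _; lra.
Qed.

(** Either an entry is dropped from the coprime sublist, which saves one prime, or all of [xs] is
    pairwise coprime. *)
Lemma lcms_gt2_le xs : all (ltn 2%N) xs -> (1 < size xs)%N ->
  (lcms xs)%:R <= l (size xs).-1 * \prod_(x <- xs) (x%:R - 1).
Proof.
move=> xs_gt2 size_xs.
have xs_gt1 : all (ltn 1%N) xs by apply: sub_all xs_gt2 => x; apply: ltnW.
have [ys [sub_ys cop_ys /le_trans]] := lcms_le_coprime xs_gt1.
apply; rewrite ler_wpM2r ?prod_subr1_ge0 //.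
have [lt_size|ge_size] := ltnP (size ys) (size xs).
  have ys_gt1 : all (ltn 1%N) ys.
    by apply/allP => y /(mem_subseq sub_ys) /(allP xs_gt1).
  apply: le_trans (prod_pred_ratio_coprime ys_gt1 cop_ys) _.
  by rewrite l_le // -ltnS prednK // ltnW.
have eq_ys : ys = xs.
  by apply/eqP; rewrite -(size_subseq_leqif sub_ys) eqn_leq size_subseq.
by rewrite eq_ys in cop_ys *; apply: prod_pred_ratio_coprime_gt2.
Qed.

(** * Orbits of a self-map of a finite set *)

Lemma fconnect_predecessor (I : finType) (f : I -> I) x y :
  fconnect f x y -> x = y \/ exists2 z, fconnect f x z & f z = y.
Proof.
move=> /iter_findex; case: (findex f x y) => [|k] /= eq_y; first by left.
by right; exists (iter k f x); rewrite ?fconnect_iter.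
Qed.

Lemma fconnect_closed (I : finType) (f : I -> I) (A : {pred I}) x y :
  {homo f : i / i \in A} -> fconnect f x y -> x \in A -> y \in A.
Proof.
move=> fA /iter_findex <- xA.
by elim: (findex f x y) => //= k IH; apply: fA.
Qed.

Section SurjectiveSubset.
Variables (I : finType) (f : I -> I) (U : {set I}).
Hypothesis f_closed : {homo f : i / i \in U}.
Hypothesis f_surj : forall i, i \in U -> exists2 j, j \in U & f j = i.

Lemma surj_inj : {in U &, injective f}.
Proof.
apply/imset_injP; rewrite eqn_leq leq_imset_card subset_leq_card //.
by apply/subsetP => i /f_surj[j jU <-]; apply: imset_f.
Qed.

Definition orbit_set t : {set I} := [set i | fconnect f t i].

Lemma mem_orbit_set t : t \in orbit_set t.
Proof. by rewrite inE. Qed.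

Lemma orbit_set_closed t : {homo f : i / i \in orbit_set t}.
Proof.
by move=> i; rewrite !inE => /connect_trans; apply; apply: fconnect1.
Qed.

Lemma orbit_set_sub t : t \in U -> orbit_set t \subset U.
Proof.
move=> tU; apply/subsetP => i; rewrite inE.
by move=> /(fconnect_closed f_closed); apply.
Qed.

Lemma imset_orbit_set t : t \in U -> f @: orbit_set t = orbit_set t.
Proof.
move=> tU; apply/eqP; rewrite eqEcard; apply/andP; split.
  by apply/subsetP => _ /imsetP[i iO ->]; apply: orbit_set_closed.
rewrite card_in_imset // => i j iO jO.
by apply: surj_inj; apply: (subsetP (orbit_set_sub tU)).
Qed.

(** [f] permutes [U], so a forward orbit is a whole cycle and contains its preimages in [U]. *)
Lemma orbit_set_stable t i : t \in U -> i \in U ->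
  f i \in orbit_set t -> i \in orbit_set t.
Proof.
move=> tU iU; rewrite -{1}(imset_orbit_set tU) => /imsetP[j jO eq_f].
by rewrite (surj_inj iU _ eq_f) // (subsetP (orbit_set_sub tU)).
Qed.

Lemma prod_orbit_set (A : comNzRingType) (F : I -> A) t : t \in U ->
  \prod_(i in orbit_set t) F (f i) = \prod_(i in orbit_set t) F i.
Proof.
move=> tU; rewrite -[in RHS](imset_orbit_set tU) big_imset //.
by move=> i j iO jO; apply: surj_inj; apply: (subsetP (orbit_set_sub tU)).
Qed.

Lemma card_orbit_set t : #|orbit_set t| = order f t.
Proof. by rewrite /orbit_set cardsE. Qed.

Lemma prod_orbit_set_iter (F : I -> nat) t :
  (\prod_(i in orbit_set t) F i = \prod_(j < #|orbit_set t|) F (iter j f t))%N.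
Proof.
rewrite card_orbit_set.
rewrite (eq_bigl (mem (orbit f t))); last first.
  by move=> i; rewrite inE fconnect_orbit.
rewrite -big_uniq ?orbit_uniq // /orbit.
rewrite -(big_mkord xpredT (fun j => F (iter j f t))).
rewrite -(mkseq_nth t (traject f t _)) size_traject /mkseq big_map.
rewrite -[X in iota _ X]subn0 -/(index_iota 0 _) big_nat [RHS]big_nat.
by apply: eq_bigr => j hj; rewrite nth_traject.
Qed.

End SurjectiveSubset.

(** * Denominators of the v_i/d along the functional graph of [kap] *)

Section Weights.
Variables (I : finType) (d : nat) (v al : I -> nat) (kap : I -> I).
Hypothesis d_gt0 : (0 < d)%N.
Hypothesis v_gt0 : forall i, (0 < v i)%N.
Hypothesis v_half : forall i, (2 * v i <= d)%N.
Hypothesis kapE : forall i, (al i * v i + v (kap i) = d)%N.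
Hypothesis al_ge2 : forall i, kap i != i -> (1 < al i)%N.

(* At a fixed point of [kap], [al i] is d / v i - 1, so that a fixed point is
   treated as an odd cycle of length one. *)
Let u i : rat := (d%:R - (v i)%:R) / d%:R.
Let mfac i : rat := (d%:R - (v i)%:R) / (v i)%:R.

Let vR_gt0 i : 0 < (v i)%:R :> rat. Proof. by rewrite ltr0n. Qed.
Let dR_gt0 : 0 < d%:R :> rat. Proof. by rewrite ltr0n. Qed.
Let v_halfR i : 2 * (v i)%:R <= d%:R :> rat.
Proof. by rewrite -natrM ler_nat. Qed.

Lemma al_gt0 i : (0 < al i)%N.
Proof.
have := kapE i; have := v_half (kap i); have := v_gt0 (kap i).
by case: (al i) => //; lia.
Qed.

Lemma u_gt0 i : 0 < u i.
Proof. by rewrite divr_gt0 //; have := vR_gt0 i; have := v_halfR i; lra. Qed.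

Lemma u_le1 i : u i <= 1.
Proof. by rewrite ler_pdivrMr //; have := vR_gt0 i; lra. Qed.

Lemma mfac_gt0 i : 0 < mfac i.
Proof. by rewrite divr_gt0 //; have := vR_gt0 i; have := v_halfR i; lra. Qed.

(** [kapE] says that [al i * v i] is d times [u (kap i)]. This identity makes products along the
    graph telescope. *)
Lemma al_u i : (al i)%:R * u i = u (kap i) * mfac i.
Proof.
have alE : (al i)%:R * (v i)%:R = d%:R - (v (kap i))%:R :> rat.
  by rewrite -natrM -[in RHS](kapE i) natrD addrK.
rewrite /u -alE /mfac; field.
by rewrite (gt_eqF dR_gt0) (gt_eqF (vR_gt0 i)).
Qed.

Lemma al_u_ge i : (al i)%:R - 1 <= (al i)%:R * u i.
Proof.
have alE : (al i)%:R * (v i)%:R + (v (kap i))%:R = d%:R :> rat.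
  by rewrite -natrM -natrD kapE.
rewrite /u mulrA ler_pdivlMr // mulrBr mulrBl mul1r lerD2l lerN2 -alE.
by rewrite lerDl ltW.
Qed.

(** Modulo d, v (kap i) is -al i * v i: a denominator passes forward for free, and backward
    ([dvdn_al]) at the cost of [al i]. *)
Lemma dvdn_kap P i : (d %| P * v i)%N -> (d %| P * v (kap i))%N.
Proof.
move=> dP; have : (d %| P * (al i * v i + v (kap i)))%N.
  by rewrite kapE dvdn_mull.
by rewrite mulnDr dvdn_addr // mulnCA dvdn_mull.
Qed.

Lemma dvdn_al P i : (d %| P * v (kap i))%N -> (d %| P * al i * v i)%N.
Proof.
move=> dP; have : (d %| P * (al i * v i + v (kap i)))%N.
  by rewrite kapE dvdn_mull.
by rewrite mulnDr dvdn_addl // mulnA.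
Qed.

Lemma dvdz_iter t k :
  (d %| (v (iter k kap t))%:Z -
     (-1) ^+ k * (\prod_(j < k) al (iter j kap t))%:Z * (v t)%:Z)%Z.
Proof.
elim: k => [|k IH]; first by rewrite big_ord0 expr0 !mul1r subrr dvdz0.
rewrite big_ord_recr /= exprS PoszM.
set w := iter k kap t in IH *; set A := (\prod_(j < k) _)%N in IH *.
have -> : (v (kap w))%:Z - -1 * (-1) ^+ k * (A%:Z * (al w)%:Z) * (v t)%:Z =
    d%:Z - (al w)%:Z * ((v w)%:Z - (-1) ^+ k * A%:Z * (v t)%:Z).
  have -> : d%:Z = (al w)%:Z * (v w)%:Z + (v (kap w))%:Z.
    by rewrite -PoszM -PoszD kapE.
  ring.
by rewrite rpredB ?dvdzz // dvdz_mull.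
Qed.

Section Cycle.
Variables (U : {set I}) (t : I).
Hypothesis kap_closed : {homo kap : i / i \in U}.
Hypothesis kap_surj : forall i, i \in U -> exists2 j, j \in U & kap j = i.
Hypothesis tU : t \in U.

Let O := orbit_set kap t.

(** Multiply [al_u] around the cycle: [kap] permutes it, so the factors [u] cancel. *)
Lemma cycle_prod : \prod_(i in O) mfac i = (\prod_(i in O) al i)%N%:R.
Proof.
have : \prod_(i in O) ((al i)%:R * u i) = \prod_(i in O) (u (kap i) * mfac i).
  by apply: eq_bigr => i _; apply: al_u.
rewrite big_split [RHS]big_split /= (prod_orbit_set kap_closed kap_surj u tU).
rewrite natr_prod mulrC => /mulfI -> //.
by apply: lt0r_neq0; apply: prodr_gt0 => i _; apply: u_gt0.
Qed.

(* Going once around the cycle gives v t = (-1)^length * A * v t modulo d. *)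
Definition cycle_den : nat :=
  if odd #|O| then (\prod_(i in O) al i).+1 else (\prod_(i in O) al i).-1.

Lemma cycle_prod_gt0 : (0 < \prod_(i in O) al i)%N.
Proof. by apply: prodn_gt0 => i; apply: al_gt0. Qed.

Lemma card_cycle1 : kap t = t -> O = [set t].
Proof.
move=> kap_t; apply/setP => i; rewrite !inE; apply/idP/eqP => [|-> //].
move=> /(@fconnect_closed _ _ (pred1 t)) /= h; apply/eqP/h; last exact/eqP.
by move=> j /eqP ->; apply/eqP.
Qed.

Lemma cycle_den_gt0 : (0 < cycle_den)%N.
Proof.
rewrite /cycle_den; case: ifP => // /negbT even_O.
(* A fixed point is a cycle of odd length; an even cycle thus has [al t] at least 2, and its product
   minus one stays positive. *)
have t_moves : kap t != t.
  by apply: contraNneq even_O => /card_cycle1 ->; rewrite cards1.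
rewrite -ltnS prednK ?cycle_prod_gt0 // (bigD1 t) ?mem_orbit_set //=.
apply: leq_trans (al_ge2 t_moves) _; rewrite leq_pmulr //.
by apply: prodn_cond_gt0 => i _; apply: al_gt0.
Qed.

Lemma cycle_den_dvd i : i \in O -> (d %| cycle_den * v i)%N.
Proof.
rewrite inE => t_i.
apply: (@fconnect_closed _ kap [pred i | (d %| cycle_den * v i)%N]) t_i _.
  by move=> j; apply: dvdn_kap.
rewrite inE; have := dvdz_iter t #|O|.
rewrite -prod_orbit_set_iter -/O card_orbit_set.
rewrite (iter_order_in kap_closed (surj_inj kap_surj)) //.
rewrite -card_orbit_set -/O /cycle_den -signr_odd; case: ifP => _.
  rewrite expr1 mulN1r mulNr opprK -PoszM -PoszD -mulSn.
  by rewrite mulSnr addnC.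
have := cycle_prod_gt0; case: (\prod_(i in O) al i)%N => // A _.
by rewrite expr0 mul1r -PoszM mulSn PoszD opprD addrA subrr add0r rpredN.
Qed.

Lemma cycle_den_le : (cycle_den <= (\prod_(i in O) al i).+1)%N.
Proof.
rewrite /cycle_den; case: ifP => // _.
exact: leq_trans (leq_pred _) (leqnSn _).
Qed.

End Cycle.

Lemma prod_mfac_gt0 (S : {set I}) : 0 < \prod_(i in S) mfac i.
Proof. by apply: prodr_gt0 => i _; apply: mfac_gt0. Qed.

Lemma prod_u_le1 (P : pred I) : 0 < \prod_(i | P i) u i <= 1.
Proof.
apply/andP; split; first by apply: prodr_gt0 => i _; apply: u_gt0.
by apply: prodr_ile1 => i _; rewrite u_le1 ltW ?u_gt0.
Qed.

Lemma prod_u_subset (S T : {set I}) :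
  S \subset T -> \prod_(i in T) u i <= \prod_(i in S) u i.
Proof.
move=> sub_ST; rewrite (big_setID S) (setIidPr sub_ST) /=.
have /andP[_ le1] := prod_u_le1 (mem (T :\: S)).
by rewrite ler_piMr // ltW //; have /andP[] := prod_u_le1 (mem S).
Qed.

Definition generates (T S : {set I}) : Prop :=
  forall i, i \in S -> exists2 t, t \in T & fconnect kap t i.

(** With A the product of [al] on the cycle, [cycle_den] is at most A + 1, and multiplying by 1 - v
    t/d removes at least 1 because d <= cycle_den * v t. *)
Lemma cycle_den_u t (U : {set I}) : {homo kap : i / i \in U} ->
  (forall i, i \in U -> exists2 j, j \in U & kap j = i) -> t \in U ->
  (cycle_den t)%:R * u t <= \prod_(i in orbit_set kap t) mfac i.
Proof.
move=> U_closed U_surj tU; rewrite (cycle_prod U_closed U_surj tU).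
have dvd_t := cycle_den_dvd U_closed U_surj tU (mem_orbit_set kap t).
have den_gt0 := cycle_den_gt0 t.
have le_d : d%:R <= (cycle_den t)%:R * (v t)%:R :> rat.
  by rewrite -natrM ler_nat dvdn_leq // muln_gt0 den_gt0 v_gt0.
have : (cycle_den t)%:R <= (\prod_(i in orbit_set kap t) al i)%N%:R + 1 :> rat.
  by rewrite natr1 ler_nat cycle_den_le.
rewrite /u mulrA ler_pdivrMr // mulrBr.
set B := (cycle_den t)%:R; set A := (_%:R : rat) => le_B.
have := ler_wpM2r (ltW dR_gt0) le_B; rewrite mulrDl mul1r.
by move: le_d; rewrite -/B; lra.
Qed.

(* The factors u t are what is lost when further vertices are attached to t: a
   vertex i with kap i = t multiplies the denominator by al i, while
   mfac i = al i * u i / u t. *)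
Lemma reach_bound (S T : {set I}) : {homo kap : i / i \in S} ->
  T \subset S -> generates T S ->
  exists P : nat, [/\ (0 < P)%N, forall i, i \in S -> (d %| P * v i)%N &
    P%:R * \prod_(t in T) u t <= \prod_(i in S) mfac i].
Proof.
have [k] := ubnP #|S|; elim: k S T => // k IH S T /ltnSE card_S.
move=> S_closed sub_TS gen.
have [S0|[i0 i0S]] := set_0Vmem S.
  exists 1%N; split=> // [i|]; first by rewrite S0 inE.
  have -> : T = set0 by apply/eqP; rewrite -subset0 -S0.
  by rewrite S0 !big_set0 mul1r.
have [/exists_inP[j jS /forall_inP j_leaf]|] :=
    boolP [exists j in S, [forall i in S, kap i != j]].
  (* A leaf has no predecessor in [S], so it must be its own generator. It is then removed and
     [kap j] generates in its place. *)
  have jT : j \in T.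
    have [t tT /fconnect_predecessor[<- //|[i ti eq_j]]] := gen _ jS.
    have iS := fconnect_closed S_closed ti (subsetP sub_TS _ tT).
    by have := j_leaf _ iS; rewrite eq_j eqxx.
  pose S' := S :\ j; pose T' := kap j |: (T :\ j).
  have kjS' : kap j \in S' by rewrite !inE j_leaf ?S_closed.
  have [||||P [P_gt0 dvdP leP]] := IH S' T'.
  - by apply: leq_trans card_S; rewrite [X in (_ < X)%N](cardsD1 j) jS.
  - by move=> i; rewrite !inE => /andP[_ iS]; rewrite j_leaf ?S_closed.
  - by rewrite subUset sub1set kjS' setSD.
  - move=> i; rewrite !inE => /andP[neq_ij iS].
    have [t tT] := gen _ iS; rewrite fconnect_eqVf.
    case/orP=> [/eqP eq_ti|kt_i].
      by exists i; rewrite ?connect0 // !inE neq_ij -eq_ti tT orbT.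
    have [eq_tj|neq_tj] := eqVneq t j.
      by exists (kap j); [rewrite !inE eqxx | rewrite -eq_tj].
    exists t; first by rewrite !inE neq_tj tT orbT.
    exact: connect_trans (fconnect1 _ _) kt_i.
  exists (P * al j)%N; split.
  - by rewrite muln_gt0 P_gt0 al_gt0.
  - move=> i iS; have [->|neq_ij] := eqVneq i j.
      by apply: dvdn_al; apply: dvdP.
    by rewrite mulnAC dvdn_mulr // dvdP // !inE neq_ij.
  rewrite (big_setD1 _ jT) (big_setD1 _ jS) /= natrM mulrA -(mulrA P%:R) al_u.
  rewrite [P%:R * _]mulrCA [_ * (P%:R * _)]mulrC -mulrA.
  (* If [kap j] was already a generator, its factor would occur twice on the left; [u] is at most
     1. *)
  have le_T : u (kap j) * \prod_(t in T :\ j) u t <= \prod_(t in T') u t.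
    have [in_T|notin_T] := boolP (kap j \in T :\ j).
      rewrite /T' (setUidPr _) ?sub1set // ler_piMl ?u_le1 // ltW //.
      by have /andP[] := prod_u_le1 (mem (T :\ j)).
    by rewrite /T' big_setU1.
  have P_ge0 : 0 <= P%:R * mfac j :> rat.
    by rewrite mulr_ge0 ?ler0n // ltW ?mfac_gt0.
  apply: le_trans (ler_wpM2l P_ge0 le_T) _.
  by rewrite mulrAC mulrC ler_wpM2l // ltW ?mfac_gt0.
rewrite negb_exists => /forallP no_leaf.
(* Without leaves [kap] permutes [S], and the whole cycle through a generator can be split off. *)
have S_surj i : i \in S -> exists2 j, j \in S & kap j = i.
  move=> iS; have := no_leaf i; rewrite iS negb_forall /= => /existsP[j].
  by rewrite negb_imply negbK => /andP[jS /eqP <-]; exists j.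
have [t tT _] := gen _ i0S; have tS := subsetP sub_TS _ tT.
pose O := orbit_set kap t.
have tO : t \in O := mem_orbit_set _ _.
have sub_OS : O \subset S := orbit_set_sub S_closed tS.
have O_stable i : i \in S -> kap i \in O -> i \in O.
  exact: orbit_set_stable.
have [||||P [P_gt0 dvdP leP]] := IH (S :\: O) (T :\: O).
- apply: leq_trans card_S.
  rewrite -[X in (_ < X)%N](cardsID O S) (setIidPr sub_OS).
  by rewrite -[X in (X < _)%N]add0n ltn_add2r; apply/card_gt0P; exists t.
- move=> i /setDP[iS iO]; apply/setDP; split; first exact: S_closed.
  by apply: contra iO; apply: O_stable.
- exact: setSD.
- move=> i /setDP[iS iO]; have [t' t'T t'_i] := gen _ iS.
  exists t' => //; apply/setDP; split=> //; apply: contra iO => t'O.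
  by apply: (fconnect_closed (@orbit_set_closed _ kap t)) t'_i t'O.
exists (cycle_den t * P)%N; split.
- by rewrite muln_gt0 cycle_den_gt0.
- move=> i iS; have [iO|iO] := boolP (i \in O).
    by rewrite mulnAC dvdn_mulr // (cycle_den_dvd S_closed S_surj tS).
  by rewrite -mulnA dvdn_mull // dvdP //; apply/setDP.
rewrite (big_setID O) [leRHS](big_setID O) /= (setIidPr sub_OS) natrM mulrACA.
have le_T : \prod_(i in T :&: O) u i <= u t.
  have <- : \prod_(i in [set t]) u i = u t by rewrite big_set1.
  by apply: prod_u_subset; rewrite sub1set inE tT.
have uT_ge0 (A : {set I}) : 0 <= \prod_(i in A) u i.
  by have /andP[/ltW] := prod_u_le1 (mem A).
apply: ler_pM => //; try by rewrite mulr_ge0 ?ler0n.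
apply: le_trans (cycle_den_u S_closed S_surj tS).
by rewrite ler_wpM2l ?ler0n.
Qed.

(** In each fibre of [kap] one factor is kept and the others are at most 1. *)
Lemma imset_prod_u (A : {set I}) :
  \prod_(i in A) u (kap i) <= \prod_(j in kap @: A) u j.
Proof.
rewrite (partition_big_imset kap); apply: ler_prod => _ /imsetP[i iA ->].
rewrite (bigD1 i) /=; last by rewrite iA eqxx.
apply/andP; split.
  by rewrite mulr_ge0 ?ltW ?u_gt0 // prodr_gt0 // => j _; apply: u_gt0.
rewrite ler_piMr ?(ltW (u_gt0 _)) // prodr_ile1 // => j _.
by rewrite u_le1 ltW ?u_gt0.
Qed.

Definition leaves (S : {set I}) : {set I} :=
  [set i in S | [forall j in S, kap j != i]].

(* The entries of xs belong to the ends of the graph: al i for a leaf i, and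
   1 + prod al for an odd cycle that no leaf reaches. There are as many of them
   as vertices only when every vertex is a fixed point. *)
Definition denominator_data (S : {set I}) (P : nat) (xs : seq nat) : Prop :=
  [/\ (0 < P)%N /\ all (ltn 1%N) xs, (size xs <= #|S|)%N,
      size xs = #|S| -> forall x, x \in xs -> exists i, (x * v i)%N = d,
      forall i, i \in S -> (d %| P * lcms xs * v i)%N &
      P%:R * \prod_(x <- xs) (x%:R - 1) <= \prod_(i in S) mfac i].

(** [reach_bound] handles the image of [S], generated by the images of the leaves. A single multiple
    of all [al i] then serves every leaf at once, hence the lcm. *)
Lemma leaves_data (S : {set I}) : {homo kap : i / i \in S} ->
  generates (leaves S) S -> exists P xs, denominator_data S P xs.
Proof.
move=> S_closed gen; pose L := leaves S.
have leafP i : i \in L -> i \in S /\ forall j, j \in S -> kap j != i.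
  by rewrite inE => /andP[iS /forall_inP].
have S_eq : S = L :|: kap @: S.
  apply/setP => i; rewrite !inE; apply/idP/idP.
    move=> iS; rewrite iS /=; have [//|] := boolP [forall j in S, kap j != i].
    rewrite negb_forall => /existsP[j]; rewrite negb_imply negbK /=.
    by move=> /andP[jS /eqP <-]; apply: imset_f.
  by case/orP=> [/andP[iS _] //|/imsetP[j jS ->]]; apply: S_closed.
have L_disj : [disjoint L & kap @: S].
  rewrite disjoint_subset; apply/subsetP => i /leafP[iS i_leaf].
  rewrite inE; apply/imsetP => -[j /i_leaf /negP neq eq_i].
  by rewrite eq_i eqxx in neq.
have card_S : #|S| = (#|L| + #|kap @: S|)%N.
  by rewrite [in LHS]S_eq cardsU disjoint_setI0 // cards0 subn0.
have [|||P [P_gt0 dvdP leP]] := @reach_bound (kap @: S) (kap @: L).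
- by move=> _ /imsetP[i iS ->]; apply: imset_f; apply: S_closed.
- by apply/imsetS/subsetP => i /leafP[].
- move=> i iS1; have iS : i \in S by rewrite S_eq inE iS1 orbT.
  have [t tL] := gen _ iS; rewrite fconnect_eqVf => /predU1P[eq_ti|].
    by move/pred0P/(_ i): L_disj; rewrite /= -{1}eq_ti -/L tL iS1.
  by exists (kap t) => //; apply: imset_f.
have al_leaf i : i \in L -> (1 < al i)%N.
  by move=> /leafP[iS /(_ _ iS)]; apply: al_ge2.
exists P, [seq al i | i <- enum L]; split.
- split=> //; apply/allP => x; case/mapP=> i; rewrite mem_enum => iL ->.
  exact: al_leaf.
- by rewrite size_map -cardE card_S leq_addr.
(* Equality would make the image of [S], hence [S], empty. *)
- rewrite size_map -cardE card_S => /eqP.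
  rewrite -{1}[#|L|]addn0 eqn_add2l eq_sym cards_eq0 imset_eq0 => /eqP S0.
  by move=> x; case/mapP=> i; rewrite mem_enum => /leafP[]; rewrite S0 inE.
- move=> i; rewrite S_eq inE => /orP[iL|iS].
    have [c ->] : exists c, lcms [seq al i | i <- enum L] = (c * al i)%N.
      by apply/dvdnP/dvdn_lcms/map_f; rewrite mem_enum.
    rewrite mulnCA -mulnA dvdn_mull // dvdn_al // dvdP //.
    by apply: imset_f; case: (leafP _ iL).
  by rewrite mulnAC dvdn_mulr // dvdP.
have -> : \prod_(i in S) mfac i =
    \prod_(i in L) mfac i * \prod_(i in kap @: S) mfac i.
  rewrite -bigU //; apply: eq_bigl => i.
  by rewrite [in LHS]S_eq !inE.
rewrite big_map big_enum /=.
apply: (@le_trans _ _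
  (P%:R * (\prod_(j in kap @: L) u j * \prod_(i in L) mfac i))).
  rewrite ler_wpM2l ?ler0n //.
  apply: (@le_trans _ _ (\prod_(i in L) u (kap i) * \prod_(i in L) mfac i)).
    rewrite -big_split; apply: ler_prod => i iL /=.
    by rewrite -al_u al_u_ge subr_ge0 ler1n al_gt0.
  by rewrite ler_wpM2r ?imset_prod_u // ltW ?prod_mfac_gt0.
by rewrite mulrA mulrC ler_wpM2l // ltW ?prod_mfac_gt0.
Qed.

(** Cycles that no leaf reaches are split off one by one: odd ones add an entry to [xs], even ones a
    factor to [P]. What remains is generated by its leaves. *)
Lemma exists_denominator_data (S : {set I}) : {homo kap : i / i \in S} ->
  exists P xs, denominator_data S P xs.
Proof.
have [k] := ubnP #|S|; elim: k S => // k IH S /ltnSE card_S S_closed.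
(* U consists of cycles isolated from the rest of the graph. *)
pose U := [set i in S | [forall t in leaves S, ~~ fconnect kap t i]].
have [U0|[t tU]] := set_0Vmem U.
  apply: leaves_data => // i iS; have : i \notin U by rewrite U0 inE.
  rewrite inE iS negb_forall /= => /existsP[t].
  by rewrite negb_imply negbK => /andP[tL ti]; exists t.
have US i : i \in U -> i \in S by rewrite inE => /andP[].
have stable i : i \in S -> kap i \in U -> i \in U.
  move=> iS; rewrite !inE iS => /andP[_ /forall_inP h].
  apply/forall_inP => j jL; apply: contra (h j jL) => ji.
  exact: connect_trans ji (fconnect1 _ _).
have surj i : i \in U -> exists2 j, j \in U & kap j = i.
  move=> iU; have iS := US _ iU; have : i \notin leaves S.
    apply/negP => iL; move: iU; rewrite inE iS => /forall_inP /(_ _ iL).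
    by rewrite connect0.
  rewrite inE iS negb_forall => /existsP[j]; rewrite negb_imply negbK.
  by move=> /andP[jS /eqP eq_j]; exists j => //; apply: stable; rewrite ?eq_j.
(* The preimage [W] of [U] lies in [U] and maps onto it, so by counting [W] is [U]. *)
have U_closed : {homo kap : i / i \in U}.
  pose W := [set i in S | kap i \in U].
  have sub_WU : W \subset U.
    by apply/subsetP => i; rewrite inE => /andP[]; apply: stable.
  have /eqP W_eq : W == U.
    rewrite eqEcard sub_WU; apply: leq_trans (leq_imset_card kap W).
    apply/subset_leq_card/subsetP => i iU; have [j jU eq_j] := surj _ iU.
    by rewrite -eq_j imset_f // inE US //= eq_j.
  by move=> i; rewrite -{1}W_eq inE => /andP[].
pose O := orbit_set kap t; have tO : t \in O := mem_orbit_set _ _.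
have sub_OU : O \subset U := orbit_set_sub U_closed tU.
have sub_OS : O \subset S by apply/subsetP => i /(subsetP sub_OU) /US.
have card_eq : #|S| = (#|O| + #|S :\: O|)%N.
  by rewrite -(cardsID O S) (setIidPr sub_OS).
have O_gt0 : (0 < #|O|)%N by apply/card_gt0P; exists t.
have [||P [xs [[P_gt0 xs_gt1] size_xs eq_xs dvdP leP]]] := IH (S :\: O).
- by apply: leq_trans card_S; rewrite card_eq -[X in (X < _)%N]add0n ltn_add2r.
- move=> i /setDP[iS iO]; apply/setDP; split; first exact: S_closed.
  apply: contra iO => kiO; apply: (orbit_set_stable U_closed surj tU) => //.
  by apply: stable => //; apply: (subsetP sub_OU).
have prod_S : \prod_(i in S) mfac i =
    (\prod_(i in O) al i)%N%:R * \prod_(i in S :\: O) mfac i.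
  rewrite (big_setID O) /= (setIidPr sub_OS).
  by rewrite (cycle_prod U_closed surj tU).
have den_dvd := cycle_den_dvd U_closed surj tU.
have den_gt0 := cycle_den_gt0 t.
have al_gt0 := cycle_prod_gt0 t.
have rest_ge0 : 0 <= \prod_(i in S :\: O) mfac i by rewrite ltW ?prod_mfac_gt0.
case: (boolP (odd #|O|)) => odd_O; rewrite /cycle_den -/O in den_dvd den_gt0.
  rewrite odd_O in den_dvd den_gt0.
  set A := (\prod_(i in O) al i)%N in den_dvd al_gt0 prod_S *.
  exists P, (A.+1 :: xs); split.
  - by split=> //=; rewrite ltnS al_gt0.
  - by rewrite /= card_eq -add1n leq_add.
  - rewrite /= card_eq => eq_size x.
    (* One entry replaces [#|O|] vertices, so equality forces a fixed point, where (al t + 1) * v t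
       = d. *)
    have O1 : #|O| = 1%N by lia.
    have size_eq : size xs = #|S :\: O| by lia.
    rewrite inE => /predU1P[->|]; last exact: eq_xs.
    have /cards1P[t' O_eq] : #|O| == 1%N by rewrite O1.
    have eq_t : t = t' by apply/set1P; rewrite -O_eq.
    have kap_t : kap t = t.
      by apply/set1P; rewrite {2}eq_t -O_eq; apply: orbit_set_closed.
    exists t; rewrite /A O_eq -eq_t big_set1 mulSnr.
    by rewrite -[in RHS](kapE t) kap_t.
  - move=> i iS; rewrite lcms_cons; have [iO|iO] := boolP (i \in O).
      have /dvdnP[c ->] := dvdn_lcml A.+1 (lcms xs).
      by rewrite mulnA -mulnA dvdn_mull // den_dvd.
    have /dvdnP[c ->] := dvdn_lcmr A.+1 (lcms xs).
    by rewrite mulnCA -mulnA dvdn_mull // dvdP //; apply/setDP.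
  rewrite big_cons prod_S mulrCA ler_pM //.
  - by rewrite subr_ge0 ler1n.
  - by rewrite mulr_ge0 ?ler0n ?prod_subr1_ge0.
  - by rewrite -natr1 addrK.
rewrite (negPf odd_O) in den_dvd den_gt0.
set A := (\prod_(i in O) al i)%N in den_dvd den_gt0 al_gt0 prod_S *.
(* The even denominator A - 1 is at most A, the share of the cycle in the product of [mfac], so [P]
   can absorb it. *)
exists (A.-1 * P)%N, xs; split.
- by rewrite muln_gt0 den_gt0.
- by rewrite card_eq (leq_trans size_xs) // leq_addl.
- by rewrite card_eq => eq_size; move: size_xs; rewrite eq_size; lia.
- move=> i iS; have [iO|iO] := boolP (i \in O).
    by rewrite -(mulnA A.-1) mulnAC dvdn_mulr // den_dvd.
  by rewrite -!mulnA dvdn_mull // mulnA dvdP //; apply/setDP.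
rewrite natrM -mulrA prod_S ler_pM //.
- by rewrite mulr_ge0 ?ler0n ?prod_subr1_ge0.
- by rewrite ler_nat leq_pred.
Qed.

End Weights.

(** * From the polynomial to the weights, and the final estimate *)

Lemma axis_monomial (R : realType) n (f : {mpoly R[i][n]}) v d (i : 'I_n) :
  quasihomogeneous f v d -> isolated_singularity f ->
  exists k a, (a * v i + v k)%N = d.
Proof.
move=> f_homog f_isol; pose x (j : 'I_n) : R[i] := (j == i)%:R.
(* The unit vector [x] of the i-th axis is not a common zero of the partial derivatives; a monomial
   not vanishing there is a power of x_i. *)
have /existsP[k fk_neq0] : [exists k, f^`M(k).@[x] != 0].
  rewrite -[X in is_true X]negbK negb_exists; apply/negP => /forallP f0.
  have /f_isol/(_ i)/eqP : forall k, f^`M(k).@[x] = 0.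
    by move=> k; apply/eqP; rewrite -[_ == _]negbK f0.
  by rewrite /x eqxx oner_eq0.
have [m fm_neq0 m_axis] :
    exists2 m, (f^`M(k))@_m != 0 & forall j, j != i -> m j = 0%N.
  have /hasP[m m_supp /= m_neq0] :
      has (fun m : 'X_{1..n} => \prod_j x j ^+ m j != 0) (msupp f^`M(k)).
    apply: contraNT fk_neq0 => /hasPn m0; rewrite mevalE big_seq big1 // => m.
    by move=> /m0 /=; rewrite negbK => /eqP ->; rewrite mulr0.
  exists m => [|j neq_ji]; first by rewrite -mcoeff_msupp.
  apply/eqP; apply: contraNT m_neq0 => mj.
  by rewrite (bigD1 j) //= /x (negPf neq_ji) expr0n (negPf mj) mul0r.
exists k, (m i); rewrite -(mcoeff_mderiv_wt f_homog fm_neq0); congr addn.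
rewrite /wt (bigD1 i) //= big1 ?addn0 // => j /m_axis ->.
by rewrite mul0n.
Qed.

Lemma reduced_dvd n (v : 'I_n -> nat) d M :
  reduced v d -> (forall i, d %| M * v i)%N -> (d %| M)%N.
Proof.
move=> red dvdM; rewrite -[M]muln1 -red muln_gcdr dvdn_gcd.
apply/andP; split; last exact: dvdn_mull.
apply: (big_ind (fun g => d %| M * g)%N) => // [|a b da db].
  by rewrite muln0.
by rewrite muln_gcdr dvdn_gcd da.
Qed.

Theorem theorem4p1 (R : realType) (n : nat) (hn : (0 < n)%N)
    (f : {mpoly R[i][n]}) (v : 'I_n -> nat) (d : nat)
    (hv : forall i : 'I_n, (0 < v i)%N) (hd : (0 < d)%N)
    (hquasi : quasihomogeneous f v d)
    (hisol : isolated_singularity f)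
    (hred : reduced v d)
    (hhalf : forall i : 'I_n, (v i)%:R <= d%:R / 2 :> rat)
    (mu : nat) (hmu : is_milnor_number f mu) :
  (d%:R <= l n * mu%:R :> rat) /\
  ((forall i : 'I_n, (v i)%:R < d%:R / 2 :> rat) -> (2 <= n)%N ->
    d%:R <= l n.-1 * mu%:R :> rat).
Proof.
have v_half i : (2 * v i <= d)%N.
  by rewrite -(ler_nat rat) natrM mulrC -ler_pdivlMr.
have v_lt i : (v i < d)%N by have := v_half i; have := hv i; lia.
have /fin_all_exists[ka kaP] i : exists ka : 'I_n * nat,
    (ka.2 * v i + v ka.1)%N = d /\ (ka.1 != i -> 1 < ka.2)%N.
  have [v2|v2] := eqVneq (2 * v i)%N d.
    (* Keeps al i > 1 off the fixed points of kap. *)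
    by exists (i, 1%N); split; rewrite /= ?eqxx //; lia.
  have [k [a eq_d]] := axis_monomial i hquasi hisol.
  (* Exponent 0 would give v k = d, and exponent 1 would force v i = v k = d/2, the case treated
     above. *)
  exists (k, a); split=> //= _; case: a eq_d => [|[|a]] //=.
    by have := v_lt k; lia.
  by have := v_half i; have := v_half k; lia.
have [P [xs [[P_gt0 xs_gt1] size_xs eq_xs dvdP leP]]] :=
  exists_denominator_data hd hv v_half (fun i => (kaP i).1)
    (fun i => (kaP i).2) (S := setT) (fun i _ => in_setT _).
rewrite cardsT card_ord in size_xs eq_xs.
have le_mu :
    \prod_(i in [set: 'I_n]) ((d%:R - (v i)%:R) / (v i)%:R) <= mu%:R :> rat.
  rewrite (eq_bigl xpredT) => [|i]; last by rewrite inE.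
  rewrite prodf_div ler_pdivrMr ?prodr_gt0 // => [|i _]; last by rewrite ltr0n.
  have := prod_degree_le_milnor hv v_lt hquasi hmu.
  rewrite -(ler_nat rat) natrM !natr_prod.
  by under eq_bigr do rewrite natrB ?(ltnW (v_lt _)) //.
have le_d : d%:R <= P%:R * (lcms xs)%:R :> rat.
  rewrite -natrM ler_nat dvdn_leq ?muln_gt0 ?P_gt0 ?lcms_gt0 //.
  by apply: (reduced_dvd hred) => i; apply: dvdP.
have bound c : 0 <= c -> (lcms xs)%:R <= c * \prod_(x <- xs) (x%:R - 1) ->
    d%:R <= c * mu%:R :> rat.
  move=> c_ge0 le_lcm; apply: le_trans le_d _.
  apply: (@le_trans _ _ (P%:R * (c * \prod_(x <- xs) (x%:R - 1)))).
    by rewrite ler_wpM2l ?ler0n.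
  by rewrite mulrCA ler_wpM2l // (le_trans leP).
have bound_l m : (size xs <= m)%N -> d%:R <= l m * mu%:R :> rat.
  move=> le_m; apply: bound; first by rewrite ltW ?l_gt0.
  apply: le_trans (lcms_le xs_gt1) _.
  by rewrite ler_wpM2r ?prod_subr1_ge0 // l_le.
split=> [|v_lt2 n_ge2]; first exact: bound_l.
(* Fewer than n entries already give l(n-1). With n entries each x satisfies x * v i = d for some i,
   so the strict inequality makes x > 2. *)
have [size_n|size_ne] := eqVneq (size xs) n; last by apply: bound_l; lia.
apply: bound; first by rewrite ltW ?l_gt0.
rewrite -[in l _]size_n; apply: lcms_gt2_le; last by rewrite size_n.
apply/allP => x /(eq_xs size_n)[i x_v].
have : (2 * v i < d)%N by rewrite -(ltr_nat rat) natrM mulrC -ltr_pdivlMr.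
by rewrite -x_v ltn_pmul2r.
Qed.
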